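(* Let $a\in\,]0,1[$ and $b=\sqrt{1-a^2}$. Then the hypersphere $\mathbb{S}^{n-1}(a)\subset\mathbb{S}^n$ is properly biharmonic of index $(n-1)\bigl(1-\frac{b^2}{a^2}\bigr)$ in $\mathbb{S}^n$.
   Context: $\mathbb{S}^n\subset\mathbb{R}^{n+1}$ is the unit sphere with its canonical metric. For $a\in\,]0,1]$, $b=\sqrt{1-a^2}$, $\mathbb{S}^{n-1}(a)=\{(x,b)\in\mathbb{R}^{n+1}: x\in\mathbb{R}^n,\ |x|=a\}\subset\mathbb{S}^n$, with the induced metric. For an $m$-dimensional submanifold $M\subset\mathbb{S}^n$ with inclusion $i$ and second fundamental form $B$, the mean curvature is $H=\frac1m\operatorname{tr}B$; $M$ is harmonic in $\mathbb{S}^n$ iff $H=0$. With $\Delta=-\operatorname{tr}\nabla^2$ the (nonnegative) rough Laplacian on sections of $i^*T\mathbb{S}^n$, $M$ is biharmonic of index $k\in\mathbb{R}$ in $\mathbb{S}^n$ if $(\Delta-m+k)H=0$, and properly so if moreover $M$ is not harmonic ($H\not\equiv0$). *)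

(* Defs.v *)
From HB Require Import structures.
From mathcomp Require Import all_boot all_order all_algebra.
From mathcomp Require Import all_classical all_reals all_analysis.

Set Implicit Arguments.
Unset Strict Implicit.
Unset Printing Implicit Defensive.

Import Order.TTheory GRing.Theory Num.Theory.
Import numFieldNormedType.Exports.

Local Open Scope classical_set_scope.
Local Open Scope ring_scope.

(* The library norm `|u| on row vectors is the sup norm: it is used only for
   its topology, lengths being measured by [enorm]. *)
Definition dot (R : realType) (d : nat) (u v : 'rV[R]_d) : R :=
  \sum_(i < d) u 0 i * v 0 i.

Definition enorm (R : realType) (d : nat) (u : 'rV[R]_d) : R :=
  Num.sqrt (dot u u).

Definition sphere (R : realType) (n : nat) : set 'rV[R]_n.+1 :=
  [set p | enorm p = 1].

(* [col' ord_max p] drops the last coordinate, so p = (x, b) with x in R^n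
   reads x = col' ord_max p and b = p 0 ord_max. *)
Definition hypersphere (R : realType) (n : nat) (a : R) : set 'rV[R]_n.+1 :=
  [set p | enorm (col' ord_max p) = a /\ p 0 ord_max = Num.sqrt (1 - a ^+ 2)].

Section Calculus.
Variables (R : realType) (m : nat) (W : normedModType R).
Implicit Types (f : 'rV[R]_m -> W) (U : set 'rV[R]_m).

Definition partial (i : 'I_m) f : 'rV[R]_m -> W :=
  fun u => 'D_(delta_mx 0 i) f u.

Fixpoint Ck_on (k : nat) U f : Prop :=
  if k is k'.+1 then
    (forall u, U u -> differentiable f u) /\
    (forall i : 'I_m, Ck_on k' U (partial i f))
  else forall u, U u -> {for u, continuous f}.

Definition smooth_on U f : Prop := forall k, Ck_on k U f.

End Calculus.

(* phi : U -> M is a smooth immersion which is a homeomorphism onto a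
   relatively open subset of M. *)
Definition local_param (R : realType) (m d : nat) (M : set 'rV[R]_d)
    (U : set 'rV[R]_m) (phi : 'rV[R]_m -> 'rV[R]_d) : Prop :=
  [/\ open U,
      smooth_on U phi,
      forall u, U u -> row_free ('J phi u),
      exists2 O : set 'rV[R]_d, open O & phi @` U = M `&` O
    & exists2 psi : 'rV[R]_d -> 'rV[R]_m,
        {within phi @` U, continuous psi} & forall u, U u -> psi (phi u) = u].

Definition submanifold (R : realType) (m d : nat) (M : set 'rV[R]_d) : Prop :=
  forall p, M p -> exists (U : set 'rV[R]_m) (phi : 'rV[R]_m -> 'rV[R]_d),
    local_param M U phi /\ (phi @` U) p.

(* Local expressions, in a parametrization phi : U -> M, of the Riemannian
   objects of a submanifold M of the sphere S^n.  A section V of i^*TS^n is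
   represented by u |-> V(phi u), a map into R^(n+1) orthogonal to phi. *)
Section LocalGeometry.
Variables (R : realType) (m n : nat) (phi : 'rV[R]_m -> 'rV[R]_n.+1).
Implicit Types (u : 'rV[R]_m) (i j k l : 'I_m) (v : 'rV[R]_n.+1).
Implicit Types (V : 'rV[R]_m -> 'rV[R]_n.+1).

(* Induced metric g_ij and its inverse g^ij. *)
Definition metric u : 'M[R]_m :=
  \matrix_(i, j) dot (partial i phi u) (partial j phi u).

Definition cometric u : 'M[R]_m := invmx (metric u).

(* Christoffel symbols Gamma^k_ij of the Levi-Civita connection of g. *)
Definition christoffel k i j u : R :=
  2^-1 * \sum_(l < m) cometric u k l *
    (partial i (fun w => metric w j l) u + partial j (fun w => metric w i l) u
     - partial l (fun w => metric w i j) u).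

(* nabla_(d_i) V for the pull-back to M of the Levi-Civita connection of S^n:
   the orthogonal projection of the Euclidean derivative onto T_(phi u) S^n. *)
Definition nablaS i V : 'rV[R]_m -> 'rV[R]_n.+1 :=
  fun u => partial i V u - dot (partial i V u) (phi u) *: phi u.

(* Component of v orthogonal to T_(phi u) M = span of the d_k phi. *)
Definition normal_part u v : 'rV[R]_n.+1 :=
  v - \sum_(k < m) \sum_(l < m)
        (cometric u k l * dot v (partial k phi u)) *: partial l phi u.

(* B(d_i, d_j) *)
Definition second_fundamental_form i j u : 'rV[R]_n.+1 :=
  normal_part u (nablaS i (partial j phi) u).

Definition mean_curvature u : 'rV[R]_n.+1 :=
  m%:R^-1 *: \sum_(i < m) \sum_(j < m)
               cometric u i j *: second_fundamental_form i j u.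

(* (nabla^2 V)(d_i, d_j) = nabla_i nabla_j V - Gamma^k_ij nabla_k V *)
Definition nabla2 i j V u : 'rV[R]_n.+1 :=
  nablaS i (nablaS j V) u - \sum_(k < m) christoffel k i j u *: nablaS k V u.

Definition rough_laplacian V u : 'rV[R]_n.+1 :=
  - \sum_(i < m) \sum_(j < m) cometric u i j *: nabla2 i j V u.

End LocalGeometry.

Section Biharmonic.
Variables (R : realType) (m n : nat) (M : set 'rV[R]_n.+1).

Definition harmonic : Prop :=
  forall (U : set 'rV[R]_m) (phi : 'rV[R]_m -> 'rV[R]_n.+1),
    local_param M U phi -> forall u, U u -> mean_curvature phi u = 0.

Definition biharmonic (k : R) : Prop :=
  [/\ submanifold m M,
      M `<=` @sphere R n
    & forall (U : set 'rV[R]_m) (phi : 'rV[R]_m -> 'rV[R]_n.+1),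
        local_param M U phi -> forall u, U u ->
        let H := mean_curvature phi in
        rough_laplacian phi H u - m%:R *: H u + k *: H u = 0].

Definition properly_biharmonic (k : R) : Prop := biharmonic k /\ ~ harmonic.

End Biharmonic.

Arguments sphere {R} n.
Arguments hypersphere {R} n a.
Arguments submanifold {R} m {d} M.
Arguments harmonic {R} m {n} M.
Arguments biharmonic {R} m {n} M k.
Arguments properly_biharmonic {R} m {n} M k.

(* Main.v *)
Require Import Defs.
From HB Require Import structures.
From mathcomp Require Import all_boot all_order all_algebra.
From mathcomp Require Import all_classical all_reals all_analysis.
From mathcomp Require Import ring lra.

Set Implicit Arguments.
Unset Strict Implicit.
Unset Printing Implicit Defensive.

Import Order.TTheory GRing.Theory Num.Theory.
Import numFieldNormedType.Exports.

Local Open Scope classical_set_scope.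
Local Open Scope ring_scope.

(** Write [m = n - 1].  Along a parametrization [phi] of the hypersphere
    [M = S^m(a)] the unit vector [eta = (b / a) phi - (1 / a) e], where [e] is
    the last basis vector, is normal to [M] and tangent to the ambient sphere.
    Its derivatives are [d_j eta = (b / a) d_j phi], so [M] is totally umbilical
    with constant curvature: [B(d_i, d_j) = - (b / a) g_ij eta]
    ([second_fundamental_formE]) and [H = - (b / a) eta] ([mean_curvatureE]),
    which vanishes nowhere.

    Consequently [nabla_j H = - (b / a)^2 d_j phi], and a second differentiation
    reproduces the second fundamental form: by the Gauss formula
    ([gauss_formula]), [nabla_i d_j phi - Gamma^k_ij d_k phi = B(d_i, d_j)],
    hence [(nabla^2 H)(d_i, d_j) = - (b / a)^2 B(d_i, d_j)].  Taking the trace,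
    [Delta H = m (b / a)^2 H] ([rough_laplacian_mean_curvature]), and
    [m (b / a)^2 - m + m (1 - (b / a)^2) = 0] is the claimed index.

    The Gauss formula with the Christoffel symbols expressed by first
    derivatives of the metric rests on the symmetry of second partial
    derivatives, proved here from the mean value theorem ([schwarz]).  The
    normal space of [M] in [R^(m + 2)] is identified by a dimension count: [m]
    independent tangent vectors and the orthonormal pair [phi], [eta] leave no
    room for a further direction ([normal_plane]).

    Finally, that [M] is a submanifold, and that it has a parametrization on
    which [H] can be seen not to vanish, follows from stereographic projection
    from the two poles on the first coordinate axis.  These charts are defined
    on all of [R^m] and have components in the algebra generated by the
    coordinates and [1 / (1 + |u|^2)], which is stable under differentiation;
    this gives smoothness of every order at once ([rational_smooth]). *)

(** * Symmetry of second derivatives *)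

Section Schwarz.
Variables (R : realType) (V : normedModType R).
Implicit Types (f : V -> R) (u v w x : V).

Lemma is_derive_line f x v (s df : R) : is_derive (s *: v + x) v f df ->
  is_derive s 1 (fun r : R => f (r *: v + x)) df.
Proof.
have E : (fun h : R => h^-1 *:
    (((fun r : R => f (r *: v + x)) \o shift s) (h *: (1 : R))
     - f (s *: v + x))) =
  (fun h : R => h^-1 *: ((f \o shift (s *: v + x)) (h *: v) - f (s *: v + x))).
  by apply/funext => h /=; rewrite [h *: 1]mulr1 scalerDl addrA.
by case=> d <-; apply: DeriveDef; rewrite /derivable /derive E.
Qed.

Lemma MVT_line f (f' : V -> R) x v (t : R) : 0 < t ->
  (forall s, s \in `[0, t] -> is_derive (s *: v + x) v f (f' (s *: v + x))) ->
  exists2 c, c \in `[0, t]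
    & f (t *: v + x) - f x = t * f' (c *: v + x).
Proof.
move=> t0 df; pose g (r : R) : R := f (r *: v + x).
pose g' (r : R) : R := f' (r *: v + x).
have dg s : s \in `[0, t] -> is_derive s 1 g (g' s).
  by move=> si; apply: is_derive_line; exact: df.
have gc : {within `[0, t], continuous g}.
  by apply: derivable_within_continuous => s si; have [] := dg s si.
have dgo s : s \in `]0, t[ -> is_derive s 1 g (g' s).
  by move=> si; apply: dg; exact: (subset_itv_oo_cc si).
have [c cI] := MVT t0 dgo gc.
rewrite /g /g' scale0r add0r subr0 mulrC => E.
by exists c => //; exact: (subset_itv_oo_cc cI).
Qed.

(** The mean value theorem is applied to the increment [f (t *: w + x) - f x]
    in the direction [v], then to [fv] in the direction [w].  The expression on
    the left is symmetric in [v] and [w], which is what [schwarz] exploits. *)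
Lemma second_difference f (fv fvw : V -> R) u v w (t : R) : 0 < t ->
  (forall s r, s \in `[0, t] -> r \in `[0, t] ->
    let x := s *: v + (r *: w + u) in
    is_derive x v f (fv x) /\ is_derive x w fv (fvw x)) ->
  exists s r, [/\ s \in `[0, t], r \in `[0, t] &
    f (t *: v + (t *: w + u)) - f (t *: v + u) - f (t *: w + u) + f u
    = t ^+ 2 * fvw (s *: v + (r *: w + u))].
Proof.
move=> t0 df.
have I0 : 0 \in `[0, t] by rewrite in_itv /= lexx ltW.
have It : t \in `[0, t] by rewrite in_itv /= lexx ltW.
pose g x := f (t *: w + x) - f x.
pose gv x := fv (t *: w + x) - fv x.
have dg s : s \in `[0, t] -> is_derive (s *: v + u) v g (gv (s *: v + u)).
  move=> sI; apply: is_deriveB; last first.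
    by have [+ _] := df s 0 sI I0; rewrite scale0r add0r.
  have [d _] := df s t sI It; rewrite /= addrCA in d.
  have E : (fun h : R => h^-1 *:
    (((fun x => f (t *: w + x)) \o shift (s *: v + u)) (h *: v)
      - f (t *: w + (s *: v + u)))) =
    (fun h : R => h^-1 *: ((f \o shift (t *: w + (s *: v + u))) (h *: v)
      - f (t *: w + (s *: v + u)))).
    by apply/funext => h /=; rewrite addrCA.
  by case: d => d <-; apply: DeriveDef; rewrite /derivable /derive E.
have [s sI Es] := MVT_line t0 dg.
have dfv r : r \in `[0, t] ->
    is_derive (r *: w + (s *: v + u)) w fv (fvw (r *: w + (s *: v + u))).
  by move=> rI; rewrite addrCA; have [] := df s r sI rI.
have [r rI Er] := MVT_line t0 dfv.
exists s, r; split=> //.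
move: Es; rewrite /gv Er /g [t *: w + (t *: v + u)]addrCA => E.
by rewrite expr2 -mulrA [s *: v + _]addrCA -E; ring.
Qed.

(** Schwarz's theorem: by the mean value theorem in both orders, the same second
    difference over a small parallelogram is [t ^+ 2] times a value of either
    mixed derivative, and continuity lets the parallelogram shrink to [u]. *)
Lemma schwarz f (fv fw fvw fwv : V -> R) u v w :
  (\forall x \near u, is_derive x v f (fv x)) ->
  (\forall x \near u, is_derive x w f (fw x)) ->
  (\forall x \near u, is_derive x w fv (fvw x)) ->
  (\forall x \near u, is_derive x v fw (fwv x)) ->
  {for u, continuous fvw} -> {for u, continuous fwv} -> fvw u = fwv u.
Proof.
move=> dv dw dvw dwv cvw cwv.
apply/eqP; rewrite -subr_eq0 -normr_le0; apply/ler_addgt0Pr => e e0.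
rewrite add0r.
have e20 : 0 < e / 2 by rewrite divr_gt0.
have/cvgrPdist_lt /(_ _ e20) nvw := cvw.
have/cvgrPdist_lt /(_ _ e20) nwv := cwv.
have nI P Q : nbhs u P -> nbhs u Q -> nbhs u (P `&` Q) by apply: filterI.
have nall := nI _ _ (nI _ _ (nI _ _ dv dw) (nI _ _ dvw dwv)) (nI _ _ nvw nwv).
have [d /= d0 H] := (nbhs_ballP u _).1 nall.
(* Then [t * (|v| + |w|) < d]: the parallelogram stays within the ball. *)
pose t := d / (2 * (1 + `|v| + `|w|)).
have c0 : 0 < 1 + `|v| + `|w| by rewrite -addrA ltr_pwDl// addr_ge0.
have t0 : 0 < t by rewrite /t divr_gt0// mulr_gt0.
have small s r : s \in `[0, t] -> r \in `[0, t] ->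
    ball u d (s *: v + (r *: w + u)).
  rewrite !in_itv /= => /andP[s0 st] /andP[r0 rt].
  rewrite -ball_normE /= addrA opprD addrCA subrr addr0 normrN.
  rewrite (le_lt_trans (ler_normD _ _))// !normrZ !ger0_norm//.
  apply: (@le_lt_trans _ _ (t * (1 + `|v| + `|w|))).
    rewrite !mulrDr mulr1.
    have := ler_wpM2r (normr_ge0 v) st; have := ler_wpM2r (normr_ge0 w) rt.
    lra.
  rewrite /t invfM mulrA -mulrA mulVf ?gt_eqF// mulr1.
  lra.
have [|s [r [sI rI E]]] := @second_difference f fv fvw u v w t t0.
  by move=> s r sI rI x; have [[[? _] [? _]] _] := H _ (small s r sI rI).
have [|s' [r' [sI' rI' E']]] := @second_difference f fw fwv u w v t t0.
  move=> s' r' sI' rI'; rewrite addrCA => x.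
  by have [[[_ ?] [_ ?]] _] := H _ (small r' s' rI' sI').
have swap (p q y z : R) : p - q - y + z = p - y - q + z by rewrite (addrAC p).
rewrite [t *: w + (t *: v + u)]addrCA swap E in E'.
have {E'} E' := mulfI (expf_neq0 2 (lt0r_neq0 t0)) E'.
rewrite [s' *: w + _]addrCA in E'.
have [_ [A _]] := H _ (small s r sI rI).
have [_ [_ B]] := H _ (small r' s' rI' sI').
rewrite -(subrKA (fvw (s *: v + (r *: w + u)))) {2}E'.
rewrite (le_trans (ler_normD _ _))// (splitr e) lerD// ?ltW// distrC//.
Qed.

End Schwarz.

(** * The Euclidean product *)

Section Dot.
Variables (R : realType) (d : nat).
Implicit Types (u v w : 'rV[R]_d) (c : R).

Lemma dotE u v : dot u v = (u *m v^T) 0 0.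
Proof. by rewrite /dot mxE; apply: eq_bigr => i _; rewrite !mxE. Qed.

Lemma dotC u v : dot u v = dot v u.
Proof. by apply: eq_bigr => i _; rewrite mulrC. Qed.

Lemma dotDl u v w : dot (u + v) w = dot u w + dot v w.
Proof. by rewrite !dotE mulmxDl mxE. Qed.

Lemma dotZl c u v : dot (c *: u) v = c * dot u v.
Proof. by rewrite !dotE -scalemxAl mxE. Qed.

Lemma dotNl u v : dot (- u) v = - dot u v.
Proof. by rewrite -scaleN1r dotZl mulN1r. Qed.

Lemma dotBl u v w : dot (u - v) w = dot u w - dot v w.
Proof. by rewrite dotDl dotNl. Qed.

Lemma dotDr u v w : dot w (u + v) = dot w u + dot w v.
Proof. by rewrite dotC dotDl !(dotC w). Qed.

Lemma dotZr c u v : dot u (c *: v) = c * dot u v.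
Proof. by rewrite dotC dotZl dotC. Qed.

Lemma dotBr u v w : dot w (u - v) = dot w u - dot w v.
Proof. by rewrite dotC dotBl !(dotC w). Qed.

Lemma dot_suml (I : finType) (F : I -> 'rV[R]_d) v :
  dot (\sum_i F i) v = \sum_i dot (F i) v.
Proof.
rewrite dotE mulmx_suml summxE; by apply: eq_bigr => i _; rewrite dotE.
Qed.

Lemma dot_delta u i : dot u (delta_mx 0 i) = u 0 i.
Proof.
rewrite /dot (bigD1 i)//= mxE !eqxx mulr1 big1 ?addr0// => j ji.
by rewrite mxE (negPf ji) andbF mulr0.
Qed.

Lemma dot_ge0 u : 0 <= dot u u.
Proof. by apply: sumr_ge0 => i _; rewrite -expr2 sqr_ge0. Qed.

Lemma dot_eq0 u : dot u u = 0 -> u = 0.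
Proof.
move/eqP; rewrite psumr_eq0; last by move=> i _; rewrite -expr2 sqr_ge0.
move=> /allP u0; apply/rowP => i; rewrite mxE; apply/eqP.
by have := u0 i (mem_index_enum _); rewrite /= mulf_eq0 orbb.
Qed.

End Dot.

(** * Derivatives of vector-valued maps *)

Section Derivatives.
Variables (R : realType) (V : normedModType R) (d : nat).
Implicit Types (F G : V -> 'rV[R]_d) (u v : V).

Lemma is_derive_coord F u v j : derivable F u v ->
  is_derive u v (fun x => F x 0 j) ('D_v F u 0 j).
Proof.
move=> dF; apply: DeriveDef; first by move/derivable_mxP : dF => /(_ 0 j).
by rewrite derive_mx// mxE.
Qed.

Lemma is_derive_dot F G u v : derivable F u v -> derivable G u v ->
  is_derive u v (fun x => dot (F x) (G x))
    (dot ('D_v F u) (G u) + dot (F u) ('D_v G u)).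
Proof.
move=> dF dG.
have -> : (fun x => dot (F x) (G x)) =
    \sum_(i < d) ((fun x => F x 0 i) * (fun x => G x 0 i)).
  by apply/funext => x; rewrite fct_sumE.
rewrite -big_split /=.
apply: is_derive_eq.
  apply: is_derive_sum => i.
  by apply: is_deriveM; apply: is_derive_coord.
by apply: eq_bigr => i _; rewrite /GRing.scale /= addrC (mulrC (G u 0 i)).
Qed.

End Derivatives.

Section PartialDerivatives.
Variables (R : realType) (m : nat) (W : normedModType R).
Implicit Types (f g : 'rV[R]_m -> W) (U : set 'rV[R]_m).

Lemma eq_partial U f g i u : open U -> U u -> (forall w, U w -> f w = g w) ->
  partial i f u = partial i g u.
Proof.
move=> oU Uu fg; apply: near_eq_derive.
by apply: (@filterS _ (nbhs u) _ U); [exact: fg | exact: open_nbhs_nbhs].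
Qed.

Lemma partial_val f i u (df : W) :
  is_derive u (delta_mx 0 i) f df -> partial i f u = df.
Proof. by case. Qed.

Lemma smooth_derivable U f u v : smooth_on U f -> U u -> derivable f u v.
Proof.
by move=> sf Uu; have [df _] := sf 1%N; apply: diff_derivable; exact: df.
Qed.

Lemma smooth_partial U f i : smooth_on U f -> smooth_on U (partial i f).
Proof. by move=> sf k; have [_ df] := sf k.+1; exact: df. Qed.

End PartialDerivatives.

(** * Local Riemannian geometry in a sphere *)

Section Parametrization.
Local Opaque partial.
Variables (R : realType) (m n : nat) (U : set 'rV[R]_m).
Variable phi : 'rV[R]_m -> 'rV[R]_n.+1.
Hypotheses (oU : open U) (smooth_phi : smooth_on U phi).
Hypothesis immersive : forall u, U u -> row_free ('J phi u).
Implicit Types (u : 'rV[R]_m) (i j k l : 'I_m) (v : 'rV[R]_n.+1).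

Lemma derivable_phi u (w : 'rV[R]_m) : U u -> derivable phi u w.
Proof. exact: smooth_derivable. Qed.

Lemma derivable_partial u (w : 'rV[R]_m) j :
  U u -> derivable (partial j phi) u w.
Proof. exact/smooth_derivable/smooth_partial. Qed.

Lemma partialC i j u : U u ->
  partial i (partial j phi) u = partial j (partial i phi) u.
Proof.
move=> Uu; apply/rowP => k.
have nU : nbhs u U by exact: open_nbhs_nbhs.
have d1 l x : U x ->
    is_derive x (delta_mx 0 l) (fun y => phi y 0 k) (partial l phi x 0 k).
  by move=> Ux; apply: is_derive_coord; exact: derivable_phi.
have d2 l l' x : U x -> is_derive x (delta_mx 0 l)
    (fun y => partial l' phi y 0 k) (partial l (partial l' phi) x 0 k).
  by move=> Ux; apply: is_derive_coord; exact: derivable_partial.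
have c2 l l' : {for u, continuous (fun y => partial l (partial l' phi) y 0 k)}.
  have c := smooth_partial l (smooth_partial l' smooth_phi) 0%N u Uu.
  have cc := @coord_continuous R 1 n.+1 0 k (partial l (partial l' phi) u).
  exact (continuous_comp c cc).
apply: (@schwarz R _ (fun y => phi y 0 k) (fun y => partial j phi y 0 k)
  (fun y => partial i phi y 0 k) (fun y => partial i (partial j phi) y 0 k)
  (fun y => partial j (partial i phi) y 0 k) u
  (delta_mx 0 j) (delta_mx 0 i)).
- by apply: filterS nU => x; exact: d1.
- by apply: filterS nU => x; exact: d1.
- by apply: filterS nU => x; exact: d2.
- by apply: filterS nU => x; exact: d2.
- exact: c2.
- exact: c2.
Qed.

Lemma partialE i u : U u -> partial i phi u = row i ('J phi u).
Proof.
move=> Uu; have [dphi _] := smooth_phi 1%N.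
rewrite rowE -deriveEjacobian; last exact: dphi.
by apply: partial_val; exact/derivableP/diff_derivable/dphi.
Qed.

Lemma metricC u : (metric phi u)^T = metric phi u.
Proof. by apply/matrixP => i j; rewrite mxE mxE [RHS]mxE; exact: dotC. Qed.

Lemma metric_gram u : U u -> metric phi u = 'J phi u *m ('J phi u)^T.
Proof.
move=> Uu; apply/matrixP => i j; rewrite !mxE !partialE//.
by apply: eq_bigr => k _; rewrite !mxE.
Qed.

(** If [v g = 0] then [v J] has squared length [v g v^T = 0]. *)
Lemma metric_unit u : U u -> metric phi u \in unitmx.
Proof.
move=> Uu; rewrite -row_free_unit; apply: inj_row_free => v vg0.
apply: (row_free_inj (immersive Uu)); rewrite mul0mx; apply: dot_eq0.
by rewrite dotE trmx_mul mulmxA -(mulmxA v) -metric_gram// vg0 mul0mx mxE.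
Qed.

Lemma cometricC u k l : cometric phi u k l = cometric phi u l k.
Proof. by rewrite /cometric -{1}metricC -trmx_inv mxE. Qed.

Lemma cometricK u : U u -> cometric phi u *m metric phi u = 1%:M.
Proof. by move=> Uu; rewrite mulVmx// metric_unit. Qed.

Lemma trace_metric u : U u ->
  \sum_i \sum_j cometric phi u i j * metric phi u i j = m%:R.
Proof.
move=> Uu; transitivity (\tr (cometric phi u *m metric phi u)).
  apply: eq_bigr => i _; rewrite mxE; apply: eq_bigr => j _.
  by rewrite -{1}metricC mxE.
by rewrite cometricK// mxtrace1.
Qed.

Lemma partial_metric i j k u : U u ->
  partial i (fun w => metric phi w j k) u =
  dot (partial i (partial j phi) u) (partial k phi u)
  + dot (partial j phi u) (partial i (partial k phi) u).
Proof.
move=> Uu.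
have -> : (fun w => metric phi w j k) =
    (fun w => dot (partial j phi w) (partial k phi w)).
  by apply/funext => w; rewrite mxE.
have d l : derivable (partial l phi) u (delta_mx 0 i).
  exact: derivable_partial.
by apply: partial_val; exact: is_derive_dot.
Qed.

(** In the alternating sum of the derivatives of [g], the product rule yields
    six terms; by symmetry of second derivatives those not of the form
    [dot (d_i d_j phi) (d_l phi)] cancel. *)
Lemma christoffelE k i j u : U u -> christoffel phi k i j u =
  \sum_l cometric phi u k l
         * dot (partial i (partial j phi) u) (partial l phi u).
Proof.
move=> Uu; rewrite /christoffel mulr_sumr; apply: eq_bigr => l _.
rewrite !(partial_metric _ _ _ Uu) mulrCA; congr (_ * _).
have koszul (pi pj pl hij hji hil hli hjl hlj : 'rV[R]_n.+1) :
    hji = hij -> hli = hil -> hlj = hjl ->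
    2^-1 * (dot hij pl + dot pj hil + (dot hji pl + dot pi hjl)
            - (dot hli pj + dot pi hlj)) = dot hij pl.
  by move=> -> -> ->; rewrite (dotC pj); field.
exact: koszul (partialC j i Uu) (partialC l i Uu) (partialC l j Uu).
Qed.

Hypothesis on_sphere : forall u, U u -> dot (phi u) (phi u) = 1.

(** Differentiate [dot phi phi = 1]. *)
Lemma partial_orth i u : U u -> dot (partial i phi u) (phi u) = 0.
Proof.
move=> Uu; have := @eq_partial _ _ R U (fun w => dot (phi w) (phi w))
  (cst 1) i u oU Uu on_sphere.
rewrite [RHS](partial_val (is_derive_cst _ _ _)).
have d : derivable phi u (delta_mx 0 i) by exact: derivable_phi.
rewrite (partial_val (is_derive_dot d d)).
rewrite [X in _ + X]dotC => /eqP; rewrite -mulr2n mulrn_eq0 /= => /eqP; exact.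
Qed.

(** Differentiate [dot (d_j phi) phi = 0]. *)
Lemma partial2_radial i j u : U u ->
  dot (partial i (partial j phi) u) (phi u) = - metric phi u i j.
Proof.
move=> Uu; have := @eq_partial _ _ R U (fun w => dot (partial j phi w) (phi w))
  (cst 0) i u oU Uu (@partial_orth j).
rewrite [RHS](partial_val (is_derive_cst _ _ _)).
have d : derivable phi u (delta_mx 0 i) by exact: derivable_phi.
have dj : derivable (partial j phi) u (delta_mx 0 i).
  exact: derivable_partial.
rewrite (partial_val (is_derive_dot dj d)).
move/eqP; rewrite addr_eq0 => /eqP E; rewrite mxE E; congr (- _).
exact: dotC.
Qed.

(** By [christoffelE], the Christoffel symbols are the coordinates of the
    tangential part of [d_i d_j phi], and removing the component along [phi]
    does not affect tangential parts. *)
Lemma gauss_formula i j u : U u ->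
  nablaS phi i (partial j phi) u
  - \sum_k christoffel phi k i j u *: partial k phi u
  = second_fundamental_form phi i j u.
Proof.
move=> Uu; rewrite /second_fundamental_form /normal_part; congr (_ - _).
rewrite exchange_big /=; apply: eq_bigr => k _.
rewrite christoffelE// scaler_suml; apply: eq_bigr => l _.
by rewrite cometricC dotBl dotZl (dotC (phi u)) partial_orth// mulr0 subr0.
Qed.

End Parametrization.

(** * Normal space and curvature of the hypersphere *)

Section NormalPlane.
Variables (R : realType) (m : nat).
Implicit Types (J : 'M[R]_(m, m.+2)) (p q v : 'rV[R]_m.+2).

Lemma mulmx_tr_dot J v : (forall i, dot (row i J) v = 0) -> J *m v^T = 0.
Proof.
move=> Jv; apply/matrixP => i j; rewrite ord1 [RHS]mxE -(Jv i) dotE -row_mul.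
by rewrite [RHS]mxE.
Qed.

Lemma mulmx_tr11 p q c : dot p q = c -> p *m q^T = c%:M.
Proof. by move=> <-; rewrite dotE -mx11_scalar. Qed.

(** The rows of [J] together with [p] and [q] are [m + 2] independent vectors,
    hence span the whole space, and the difference of the two sides is
    orthogonal to all of them. *)
Lemma normal_plane J p q v : row_free J ->
  (forall i, dot (row i J) p = 0) -> (forall i, dot (row i J) q = 0) ->
  dot p p = 1 -> dot q q = 1 -> dot p q = 0 ->
  (forall i, dot (row i J) v = 0) -> v = dot v p *: p + dot v q *: q.
Proof.
move=> freeJ Jp Jq pp qq pq Jv.
pose A : 'M[R]_(m + (1 + 1), m.+2) := col_mx J (col_mx p q).
have freeA : row_free A.
  apply: inj_row_free => x.
  rewrite -[x]hsubmxK -[rsubmx x]hsubmxK.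
  move: (lsubmx x) (lsubmx (rsubmx x)) (rsubmx (rsubmx x)) => y s t.
  rewrite /A !mul_row_col => E.
  have s0 : s = 0.
    have := congr1 (mulmx^~ p^T) E; rewrite !mulmxDl -!mulmxA mul0mx.
    rewrite mulmx_tr_dot// mulmx0 add0r (mulmx_tr11 pp).
    by rewrite (@mulmx_tr11 q p 0) ?raddf0 ?mulmx0 ?addr0 ?mulmx1// dotC.
  have t0 : t = 0.
    have := congr1 (mulmx^~ q^T) E; rewrite !mulmxDl -!mulmxA mul0mx.
    rewrite mulmx_tr_dot// mulmx0 add0r (mulmx_tr11 qq) (mulmx_tr11 pq).
    by rewrite raddf0 mulmx0 add0r mulmx1.
  move: E; rewrite s0 t0 !mul0mx !addr0 -[RHS](mul0mx _ J).
  by move/(row_free_inj freeJ) => ->; rewrite !row_mx0.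
have fullA : row_full A.
  by move: freeA; rewrite /row_free /row_full => /eqP ->; rewrite addnC.
apply/eqP; rewrite -subr_eq0; set w := v - _.
suff /(row_full_inj fullA) /(congr1 trmx) : A *m w^T = A *m 0.
  by rewrite trmxK trmx0 => ->.
rewrite mulmx0 /A !mul_col_mx.
have Jw : J *m w^T = 0.
  apply: mulmx_tr_dot => i.
  by rewrite dotBr dotDr !dotZr Jv Jp Jq !mulr0 addr0 subr0.
have pw : p *m w^T = 0.
  rewrite (@mulmx_tr11 p w 0) ?raddf0//.
  by rewrite dotBr dotDr !dotZr pp pq mulr0 mulr1 addr0 dotC subrr.
have qw : q *m w^T = 0.
  rewrite (@mulmx_tr11 q w 0) ?raddf0//.
  by rewrite dotBr dotDr !dotZr qq (dotC q p) pq mulr0 mulr1 add0r dotC subrr.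
by rewrite Jw pw qw !col_mx0.
Qed.

End NormalPlane.

Section HypersphereGeometry.
Variables (R : realType) (m : nat) (a b : R) (U : set 'rV[R]_m).
Variable phi : 'rV[R]_m -> 'rV[R]_m.+2.
Hypotheses (m0 : (0 < m)%N) (a0 : a != 0) (ab : a ^+ 2 + b ^+ 2 = 1).
Hypotheses (oU : open U) (smooth_phi : smooth_on U phi).
Hypothesis immersive : forall u, U u -> row_free ('J phi u).
Hypothesis on_sphere : forall u, U u -> dot (phi u) (phi u) = 1.
Hypothesis height : forall u, U u -> phi u 0 ord_max = b.
Implicit Types (u : 'rV[R]_m) (i j k l : 'I_m) (v : 'rV[R]_m.+2).
Local Opaque partial.

Let e : 'rV[R]_m.+2 := delta_mx 0 ord_max.
(** The unit normal of the hypersphere within the ambient sphere: the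
    combination of [phi] and [e] orthogonal to [phi]. *)
Let eta u : 'rV[R]_m.+2 := (b / a) *: phi u - a^-1 *: e.

Lemma dot_partial_const (F : 'rV[R]_m -> 'rV[R]_m.+2) (c : R) i u :
  smooth_on U F -> (forall w, U w -> dot (F w) e = c) -> U u ->
  dot (partial i F u) e = 0.
Proof.
move=> sF Fc Uu; have := @eq_partial _ _ R U (fun w => dot (F w) e)
  (cst c) i u oU Uu Fc.
rewrite [RHS](partial_val (is_derive_cst _ _ _)).
have d : derivable F u (delta_mx 0 i) by exact: smooth_derivable Uu.
rewrite (partial_val (is_derive_dot d (derivable_cst e u (delta_mx 0 i)))).
by rewrite derive_cst [dot _ 0]dotC -(scale0r 0) dotZl mul0r addr0.
Qed.

Lemma dot_phi_e u : U u -> dot (phi u) e = b.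
Proof. by move=> Uu; rewrite dot_delta height. Qed.

Lemma partial_e i u : U u -> dot (partial i phi u) e = 0.
Proof. exact: dot_partial_const dot_phi_e. Qed.

Lemma partial2_e i j u : U u -> dot (partial i (partial j phi) u) e = 0.
Proof.
apply: (@dot_partial_const _ 0); first exact: smooth_partial.
by move=> w; exact: partial_e.
Qed.

Lemma eta_unit u : U u -> dot (eta u) (eta u) = 1.
Proof.
move=> Uu; rewrite /eta !(dotBl, dotBr, dotZl, dotZr) on_sphere// (dotC e).
rewrite dot_phi_e// /e dot_delta mxE !eqxx /=.
apply: (mulfI (expf_neq0 2 a0)); rewrite [RHS]mulr1.
by transitivity (1 - b ^+ 2); [field | rewrite -ab; ring].
Qed.

Lemma eta_orth u : U u -> dot (phi u) (eta u) = 0.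
Proof.
by move=> Uu; rewrite /eta dotBr !dotZr on_sphere// dot_phi_e//; field.
Qed.

Lemma partial_eta_orth i u : U u -> dot (partial i phi u) (eta u) = 0.
Proof.
move=> Uu; rewrite /eta dotBr !dotZr (partial_e i Uu).
by rewrite (partial_orth oU smooth_phi on_sphere i Uu) !mulr0 subr0.
Qed.

Lemma partial2_eta i j u : U u ->
  dot (partial i (partial j phi) u) (eta u) = - (b / a) * metric phi u i j.
Proof.
move=> Uu; rewrite /eta dotBr !dotZr (partial2_e i j Uu).
rewrite (partial2_radial oU smooth_phi on_sphere i j Uu).
by rewrite mulr0 subr0 mulrN mulNr.
Qed.

(** The normal part has the same products with [phi] and [eta] as [v], and is
    orthogonal to the tangent vectors because [cometric] inverts [metric]. *)
Lemma normal_partE u v : U u ->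
  normal_part phi u v = dot v (phi u) *: phi u + dot v (eta u) *: eta u.
Proof.
move=> Uu; pose J := 'J phi u.
have rowJ i : row i J = partial i phi u by rewrite (partialE smooth_phi).
have tan_orth w : (forall i, dot (partial i phi u) w = 0) ->
    dot (normal_part phi u v) w = dot v w.
  move=> tw; rewrite /normal_part dotBl dot_suml big1 ?subr0// => k _.
  by rewrite dot_suml big1// => l _; rewrite dotZl tw mulr0.
rewrite (@normal_plane R m J (phi u) (eta u) (normal_part phi u v)).
- rewrite !tan_orth// => i; first exact: partial_eta_orth.
  exact: partial_orth oU smooth_phi on_sphere i u Uu.
- exact: immersive.
- by move=> i; rewrite rowJ; exact: partial_orth oU smooth_phi on_sphere i u Uu.
- by move=> i; rewrite rowJ; exact: partial_eta_orth.
- exact: on_sphere.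
- exact: eta_unit.
- exact: eta_orth.
move=> j; rewrite rowJ dotC /normal_part dotBl dot_suml.
under eq_bigr => k _.
  rewrite dot_suml.
  under eq_bigr => l _.
    rewrite dotZl mulrAC.
    have -> : dot (partial l phi u) (partial j phi u) = metric phi u l j.
      by rewrite mxE.
    over.
  rewrite -mulr_suml.
  have -> : \sum_l cometric phi u k l * metric phi u l j = (k == j)%:R.
    by have /matrixP/(_ k j) := cometricK smooth_phi immersive Uu; rewrite !mxE.
  over.
rewrite (bigD1 j)//= eqxx mul1r big1 ?addr0 ?subrr// => k /negPf ->.
by rewrite mul0r.
Qed.

(** Umbilicity: the only normal direction in the ambient sphere is [eta], and
    the component of [d_i d_j phi] along it comes from its component
    [- g_ij] along [phi], the height being constant. *)
Lemma second_fundamental_formE i j u : U u ->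
  second_fundamental_form phi i j u = - (b / a) *: (metric phi u i j *: eta u).
Proof.
move=> Uu; rewrite /second_fundamental_form normal_partE// !dotBl !dotZl.
rewrite on_sphere// eta_orth// mulr1 subrr scale0r add0r mulr0 subr0.
by rewrite partial2_eta// scalerA.
Qed.

Lemma trace_second_fundamental_form u : U u ->
  \sum_i \sum_j cometric phi u i j *: second_fundamental_form phi i j u
  = m%:R *: mean_curvature phi u.
Proof.
move=> Uu; rewrite /mean_curvature scalerA divff ?scale1r//.
by rewrite pnatr_eq0 -lt0n.
Qed.

Lemma mean_curvatureE u : U u -> mean_curvature phi u = - (b / a) *: eta u.
Proof.
move=> Uu; rewrite /mean_curvature.
under eq_bigr => i _.
  under eq_bigr => j _.
    rewrite second_fundamental_formE// scalerA scalerA mulrAC -scalerA.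
    over.
  rewrite -scaler_suml.
  over.
rewrite -scaler_suml (trace_metric smooth_phi immersive Uu).
by rewrite scalerK// pnatr_eq0 -lt0n.
Qed.

Lemma mean_curvature_neq0 u : b != 0 -> U u -> mean_curvature phi u != 0.
Proof.
move=> b0 Uu; rewrite mean_curvatureE// scaler_eq0 negb_or oppr_eq0.
rewrite mulf_neq0 ?invr_eq0//=; apply: contra_neq (oner_neq0 R) => eta0.
by rewrite -(eta_unit Uu) eta0 -(scale0r 0) dotZl mul0r.
Qed.

(** [H = - (b / a) eta], and [eta] differs from [(b / a) phi] by a constant. *)
Lemma nabla_mean_curvature j u : U u ->
  nablaS phi j (mean_curvature phi) u = - (b / a) ^+ 2 *: partial j phi u.
Proof.
move=> Uu.
have -> : nablaS phi j (mean_curvature phi) u =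
    nablaS phi j (fun w => - (b / a) *: eta w) u.
  by rewrite /nablaS (eq_partial j oU Uu mean_curvatureE).
have d : derivable phi u (delta_mx 0 j) by exact: smooth_derivable Uu.
have D : partial j (fun w => - (b / a) *: eta w) u =
    - (b / a) ^+ 2 *: partial j phi u.
  apply: partial_val; apply: is_derive_eq.
    apply: is_deriveZ; apply: is_deriveB.
    by apply: is_deriveZ; exact: derivableP.
  by rewrite subr0 scalerA mulNr -expr2.
rewrite /nablaS D dotZl (partial_orth oU smooth_phi on_sphere j Uu) mulr0.
by rewrite scale0r subr0.
Qed.

(** Since [nabla_j H] is a constant multiple of [d_j phi], its Hessian is the
    same multiple of the left-hand side of [gauss_formula]. *)
Lemma nabla2_mean_curvature i j u : U u ->
  nabla2 phi i j (mean_curvature phi) u =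
  - (b / a) ^+ 2 *: second_fundamental_form phi i j u.
Proof.
move=> Uu; rewrite -(gauss_formula oU smooth_phi on_sphere i j Uu) /nabla2.
rewrite scalerBr scaler_sumr; congr (_ - _); last first.
  apply: eq_bigr => k _; rewrite nabla_mean_curvature// !scalerA.
  by rewrite mulrC.
have d : derivable (partial j phi) u (delta_mx 0 i).
  exact: smooth_derivable (smooth_partial j smooth_phi) Uu.
rewrite /nablaS (eq_partial i oU Uu (@nabla_mean_curvature j)).
rewrite (partial_val (is_deriveZ (- (b / a) ^+ 2) (derivableP d))).
by rewrite dotZl scalerBr [in RHS]scalerA.
Qed.

Lemma rough_laplacian_mean_curvature u : U u ->
  rough_laplacian phi (mean_curvature phi) u =
  (m%:R * (b / a) ^+ 2) *: mean_curvature phi u.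
Proof.
move=> Uu; rewrite [_%:R * _]mulrC -scalerA -trace_second_fundamental_form//.
rewrite /rough_laplacian scaler_sumr -sumrN; apply: eq_bigr => i _.
rewrite scaler_sumr -sumrN; apply: eq_bigr => j _.
by rewrite nabla2_mean_curvature// !scalerA mulrN scaleNr opprK mulrC.
Qed.

End HypersphereGeometry.

(** * An algebra of smooth functions *)

Lemma differentiable_rV (R : realType) (V : normedModType R) (n : nat)
    (F : V -> 'rV[R]_n) (u : V) :
  (forall j, differentiable (fun x => F x 0 j : R) u) -> differentiable F u.
Proof.
move=> dF; rewrite (_ : F = \sum_(j < n) (fun x => F x 0 j *: delta_mx 0 j)).
  by apply: differentiable_sum => j; apply: differentiableZl; exact: dF.
by apply/funext => x; rewrite fct_sumE -row_sum_delta.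
Qed.

Section RationalMaps.
Variables (R : realType) (m : nat).

(** The polynomials in the coordinates and [1 / (1 + |u|^2)]: enough to write
    stereographic projection, and closed under differentiation because
    [d_i (1 / (1 + |u|^2)) = - 2 u_i / (1 + |u|^2)^2]. *)
Inductive rational : ('rV[R]_m -> R) -> Prop :=
| rational_cst c : rational (cst c)
| rational_coord i : rational (fun u => u 0 i)
| rational_inv : rational (fun u => (1 + dot u u)^-1)
| rational_add f g : rational f -> rational g -> rational (f + g)
| rational_mul f g : rational f -> rational g -> rational (f * g).

Lemma one_dot_gt0 (u : 'rV[R]_m) : 0 < 1 + dot u u.
Proof. by rewrite ltr_pwDl// dot_ge0. Qed.

Lemma rational_differentiable f u : rational f -> differentiable f u.
Proof.
elim=> [c|i||{}f g _ df _ dg|{}f g _ df _ dg].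
- exact: differentiable_cst.
- exact: differentiable_coord.
- apply: differentiableV; last by rewrite gt_eqF// one_dot_gt0.
  have -> : (fun u => 1 + dot u u) = cst 1 +
      \sum_(i < m) ((fun u : 'rV[R]_m => u 0 i) * (fun u => u 0 i)).
    by apply/funext => w; rewrite /= fctE/= fct_sumE.
  apply: differentiableD; first exact: differentiable_cst.
  by apply: differentiable_sum => i; apply: differentiableM;
    exact: differentiable_coord.
- exact: differentiableD.
- exact: differentiableM.
Qed.

Lemma rational_partial f i : rational f -> rational (partial i f).
Proof.
have dP g u : rational g -> is_derive u (delta_mx 0 i) g (partial i g u).
  by move=> rg; apply/derivableP/diff_derivable/rational_differentiable.
elim=> [c|j||{}f g rf pf rg pg|{}f g rf pf rg pg].
- have -> : partial i (cst c) = cst 0 by apply/funext => u; exact: derive_cst.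
  exact: rational_cst.
- have -> : partial i (fun u : 'rV[R]_m => u 0 j : R) =
      cst ((delta_mx 0 i : 'rV[R]_m) 0 j).
    apply/funext => u; apply: partial_val; apply: is_derive_eq.
      by apply: is_derive_coord; exact: derivable_id.
    by rewrite derive_id.
  exact: rational_cst.
- pose r (u : 'rV[R]_m) : R := (1 + dot u u)^-1.
  pose x (u : 'rV[R]_m) : R := u 0 i.
  rewrite (_ : partial i _ = cst (- 2) * x * (r * r)).
    by do !apply: rational_mul; constructor.
  apply/funext => u; rewrite /partial.
  have did : derivable id u (delta_mx 0 i) by exact: derivable_id.
  have d := is_derive_dot did did.
  have [d1 E1] := is_deriveD (is_derive_cst (1 : R) u (delta_mx 0 i)) d.
  rewrite deriveV ?gt_eqF ?one_dot_gt0// E1 derive_id (dotC _ u) dot_delta.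
  rewrite /r /x /GRing.scale /= !fctE /=.
  by field; rewrite gt_eqF ?one_dot_gt0.
- have -> : partial i (f + g) = partial i f + partial i g.
    by apply/funext => u; apply: partial_val; apply: is_deriveD; exact: dP.
  exact: rational_add.
- have -> : partial i (f * g) = f * partial i g + g * partial i f.
    by apply/funext => u; apply: partial_val; apply: is_deriveM; exact: dP.
  by apply: rational_add; apply: rational_mul.
Qed.

Lemma rational_smooth n (F : 'rV[R]_m -> 'rV[R]_n) :
  (forall j, rational (fun u => F u 0 j)) -> smooth_on setT F.
Proof.
move=> + k; elim: k F => [|k IH] F rF.
all: have dF u : differentiable F u
  by apply: differentiable_rV => j; exact: rational_differentiable.
  by move=> u _; exact: differentiable_continuous.
split=> [u _|i]; first exact: dF.
apply: IH => j; have -> : (fun u => partial i F u 0 j) =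
    partial i (fun u => F u 0 j).
  apply/funext => u; apply/esym/partial_val/is_derive_coord.
  exact: diff_derivable.
exact: rational_partial.
Qed.

End RationalMaps.

(** * Stereographic charts *)

Section Stereographic.
Variables (R : realType) (m : nat) (a : R).
Hypothesis a0 : 0 < a.
Let b := Num.sqrt (1 - a ^+ 2).
Implicit Types (u : 'rV[R]_m) (p : 'rV[R]_m.+2).

(** A vector of [R^(m + 2)] is read as its first coordinate, which carries the
    poles, then [m] coordinates matching those of [u], and the height. *)
Let i0 : 'I_m.+2 := lift ord_max ord0.
Let ik (k : 'I_m) : 'I_m.+2 := lift ord_max (lift ord0 k).

Lemma coord_split (P : 'I_m.+2 -> Prop) :
  P i0 -> (forall k, P (ik k)) -> P ord_max -> forall j, P j.
Proof.
move=> P0 Pk Pm j; case: (unliftP ord_max j) => [j' ->|->//].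
by case: (unliftP ord0 j') => [k ->|->]; [exact: Pk|exact: P0].
Qed.

Lemma sum_coord (F : 'I_m.+2 -> R) :
  \sum_j F j = F i0 + \sum_k F (ik k) + F ord_max.
Proof. by rewrite (bigD1_ord ord_max)//= big_ord_recl addrC. Qed.

Lemma hypersphereP p : hypersphere m.+1 a p <->
  p 0 i0 ^+ 2 + \sum_k p 0 (ik k) ^+ 2 = a ^+ 2 /\ p 0 ord_max = b.
Proof.
have E : dot (col' ord_max p) (col' ord_max p) =
    p 0 i0 ^+ 2 + \sum_k p 0 (ik k) ^+ 2.
  rewrite /dot big_ord_recl !mxE -expr2; congr (_ + _).
  by apply: eq_bigr => k _; rewrite !mxE -expr2.
rewrite /hypersphere /enorm /= -E; split=> -[h ->]; split=> //.
  by rewrite -h sqr_sqrtr// dot_ge0.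
by rewrite h sqrtr_sqr gtr0_norm.
Qed.

Lemma hypersphere_dot p : a < 1 -> hypersphere m.+1 a p -> dot p p = 1.
Proof.
move=> a1 /hypersphereP[E h]; rewrite /dot sum_coord -expr2.
under eq_bigr do rewrite -expr2.
rewrite E h -expr2 sqr_sqrtr ?subrKC// subr_ge0.
by rewrite expr_le1// ltW.
Qed.

(* The sign [s] selects the pole from which one projects: the point of the
   hypersphere whose first coordinate is [- s * a]. *)
Variable s : R.
Hypothesis s2 : s ^+ 2 = 1.

Let r u : R := (1 + dot u u)^-1.

(** The usual inverse stereographic projection: as [r u] is [1 / (1 + |u|^2)],
    the factor [2 * r u - 1] is [(1 - |u|^2) / (1 + |u|^2)]. *)
Definition stereo u : 'rV[R]_m.+2 :=
  \row_j if unlift ord_max j is Some j' then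
           if unlift ord0 j' is Some k then 2 * a * r u * u 0 k
           else s * a * (2 * r u - 1)
         else b.

Definition stereo_inv p : 'rV[R]_m :=
  \row_k ((a + s * p 0 i0)^-1 * p 0 (ik k)).

Lemma stereo0 u : stereo u 0 i0 = s * a * (2 * r u - 1).
Proof. by rewrite mxE liftK unlift_none. Qed.

Lemma stereok u k : stereo u 0 (ik k) = 2 * a * r u * u 0 k.
Proof. by rewrite mxE !liftK. Qed.

Lemma stereo_max u : stereo u 0 ord_max = b.
Proof. by rewrite mxE unlift_none. Qed.

Lemma r_gt0 u : 0 < r u. Proof. by rewrite invr_gt0 one_dot_gt0. Qed.

Lemma pole_distance u : a + s * stereo u 0 i0 = 2 * a * r u.
Proof. by rewrite stereo0 !mulrA -expr2 s2; ring. Qed.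

Lemma pole_distance_gt0 u : 0 < a + s * stereo u 0 i0.
Proof. by rewrite pole_distance !mulr_gt0// r_gt0. Qed.

Lemma stereo_hypersphere u : hypersphere m.+1 a (stereo u).
Proof.
apply/hypersphereP; split; last exact: stereo_max.
rewrite stereo0; under eq_bigr do rewrite stereok exprMn expr2.
rewrite -mulr_sumr; under eq_bigr do rewrite expr2.
rewrite -[\sum_k _]/(dot u u) !exprMn s2 /r; field.
by rewrite gt_eqF// one_dot_gt0.
Qed.

Lemma stereoK u : stereo_inv (stereo u) = u.
Proof.
apply/rowP => k; rewrite mxE pole_distance stereok mulKf//.
by rewrite gt_eqF// !mulr_gt0// r_gt0.
Qed.

Lemma stereo_invK p : hypersphere m.+1 a p -> 0 < a + s * p 0 i0 ->
  stereo (stereo_inv p) = p.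
Proof.
move=> /hypersphereP[E h] d0; set t := a + s * p 0 i0 in d0.
have tn0 : t != 0 by rewrite gt_eqF.
have an0 : a != 0 by rewrite gt_eqF.
have Er : r (stereo_inv p) = t / (2 * a).
  rewrite /r; have -> : dot (stereo_inv p) (stereo_inv p) =
      t ^- 2 * (a ^+ 2 - p 0 i0 ^+ 2).
    rewrite -E addrAC subrr add0r mulr_sumr; apply: eq_bigr => k _.
    by rewrite !mxE -expr2 exprMn exprVn.
  have -> : a ^+ 2 - p 0 i0 ^+ 2 = t * (2 * a - t).
    by rewrite -[p 0 i0 ^+ 2]mul1r -[in LHS]s2 /t; ring.
  have -> : 1 + t ^- 2 * (t * (2 * a - t)) = 2 * a / t by field.
  by rewrite invf_div.
apply/rowP; apply: coord_split => [|k|].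
- rewrite stereo0 Er.
  have -> : s * a * (2 * (t / (2 * a)) - 1) = s * (t - a) by field.
  by rewrite /t addrAC subrr add0r mulrA -expr2 s2 mul1r.
- by rewrite stereok Er mxE -/t; field; rewrite tn0 an0.
- by rewrite stereo_max h.
Qed.

Lemma stereo_smooth : smooth_on setT stereo.
Proof.
have rC c := @rational_cst R m c.
have rr : rational r by exact: rational_inv.
apply: rational_smooth; apply: coord_split => [|k|].
- rewrite (_ : (fun u => _) = cst (s * a) * (cst 2 * r + cst (- 1))).
    by apply: rational_mul => //; apply: rational_add => //;
      apply: rational_mul.
  by apply/funext => u; exact: stereo0.
- rewrite (_ : (fun u => _) = cst (2 * a) * r * (fun u => u 0 k)).
    by do !apply: rational_mul => //; exact: rational_coord.
  by apply/funext => u; exact: stereok.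
- by rewrite (_ : (fun u => _) = cst b)//; apply/funext => u; exact: stereo_max.
Qed.

(** If [w] is in the kernel of the differential, then differentiating the
    identity [x_k (a + s stereo_0 x) = stereo_k x] along [w] leaves
    [w_k (a + s stereo_0 u) = 0], whose second factor is positive. *)
Lemma stereo_immersive u : row_free ('J stereo u).
Proof.
apply: inj_row_free => w; have [/(_ u I) ds _] := stereo_smooth 1%N.
rewrite -deriveEjacobian// => Dw0.
have d0 j : is_derive u w (fun x => stereo x 0 j) 0.
  apply: is_derive_eq.
    by apply: is_derive_coord; exact: diff_derivable.
  by rewrite Dw0 mxE.
apply/rowP => k; rewrite [RHS]mxE.
have dk : is_derive u w (fun x : 'rV[R]_m => x 0 k) (w 0 k).
  apply: is_derive_eq.
    by apply: is_derive_coord; exact: derivable_id.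
  by rewrite derive_id.
pose g : 'rV[R]_m -> R := cst a + s \*: (fun x => stereo x 0 i0).
have dg := is_deriveD (is_derive_cst a u w) (is_deriveZ s (d0 i0)).
rewrite scaler0 addr0 -/g in dg.
have [_ E1] := is_deriveM dk dg.
have [_ E2] := d0 (ik k).
have E : (fun x : 'rV[R]_m => x 0 k) * g = (fun x => stereo x 0 (ik k)).
  apply/funext => x; rewrite stereok.
  rewrite [LHS]/(x 0 k * (a + s * stereo x 0 i0)) pole_distance.
  exact: mulrC.
move: E1; rewrite E E2 scaler0 add0r => /esym/eqP.
by rewrite scaler_eq0 gt_eqF ?pole_distance_gt0//= => /eqP.
Qed.

Lemma stereo_local_param : local_param (hypersphere m.+1 a) setT stereo.
Proof.
pose g : 'rV[R]_m.+2 -> R := cst a + s *: (fun p => p 0 i0).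
have dg p : differentiable g p.
  apply: differentiableD; first exact: differentiable_cst.
  by apply: differentiableZ; exact: differentiable_coord.
split=> //.
- exact: openT.
- exact: stereo_smooth.
- by move=> u _; exact: stereo_immersive.
- exists [set p | 0 < a + s * p 0 i0].
    by apply: (@open_comp _ _ g) (@open_gt R 0) => p _;
      exact: differentiable_continuous.
  apply/seteqP; split=> [_ [u _ <-]|p [Mp tp]].
    by split; [exact: stereo_hypersphere|exact: pole_distance_gt0].
  by exists (stereo_inv p); [|exact: stereo_invK].
- exists stereo_inv; last by move=> u _; exact: stereoK.
  apply: continuous_in_subspaceT => p /set_mem[u _ <-].
  apply: differentiable_continuous; apply: differentiable_rV => k.
  rewrite (_ : (fun p => _) =
    (fun p => (g p)^-1) * (fun p => p 0 (ik k))); last first.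
    by apply/funext => q; rewrite mxE.
  apply: differentiableM; last exact: differentiable_coord.
  apply: differentiableV; first exact: dg.
  by rewrite gt_eqF//; exact: pole_distance_gt0.
Qed.

End Stereographic.

Lemma submanifold_hypersphere (R : realType) (m : nat) (a : R) : 0 < a ->
  submanifold m (hypersphere m.+1 a).
Proof.
move=> a0 p Mp.
(* Project from the pole lying on the other side of [p]. *)
have [s s2 sp] : exists2 s : R,
    s ^+ 2 = 1 & 0 < a + s * p 0 (lift ord_max ord0).
  have [p0|p0] := leP 0 (p 0 (lift ord_max ord0)).
    by exists 1; rewrite ?expr1n// mul1r ltr_wpDr.
  by exists (-1); rewrite ?sqrrN ?expr1n// mulN1r ltr_wpDr// oppr_ge0 ltW.
exists setT, (stereo a s); split; first exact: stereo_local_param.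
by exists (stereo_inv a s p) => //; exact: stereo_invK.
Qed.

Theorem proposition1p5 (R : realType) (n : nat) (a b : R)
  (hn : (1 < n)%N) (ha0 : 0 < a) (ha1 : a < 1)
  (hb : b = Num.sqrt (1 - a ^+ 2)) :
  properly_biharmonic n.-1 (hypersphere n a)
    ((n.-1)%:R * (1 - b ^+ 2 / a ^+ 2)).
Proof.
case: n hn => // m m0; rewrite [m.+1.-1]/= in m0 *.
have b2 : a ^+ 2 + b ^+ 2 = 1.
  by rewrite hb sqr_sqrtr ?subrKC// subr_ge0 expr_le1// ltW.
have an0 : a != 0 by rewrite gt_eqF.
have bn0 : b != 0.
  by rewrite hb gt_eqF// sqrtr_gt0 subr_gt0 expr_lt1// ltW.
have in_M U phi : local_param (hypersphere m.+1 a) U phi ->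
    forall u : 'rV[R]_m, U u -> hypersphere m.+1 a (phi u).
  move=> [_ _ _ [W _ E] _] u Uu.
  by have [] : (hypersphere m.+1 a `&` W) (phi u) by rewrite -E; exists u.
have geom U phi : local_param (hypersphere m.+1 a) U phi ->
    [/\ open U, smooth_on U phi, forall u, U u -> row_free ('J phi u),
        forall u : 'rV[R]_m, U u -> dot (phi u) (phi u) = 1
      & forall u, U u -> phi u 0 ord_max = b].
  move=> lp; have [? ? ? _ _] := lp; split=> // u Uu.
    exact: hypersphere_dot (in_M _ _ lp _ Uu).
  by have [_ ->] := in_M _ _ lp _ Uu.
split; last first.
  have lp := stereo_local_param m ha0 (expr1n R 2).
  have [oT sm im sph ht] := geom _ _ lp.
  move=> /(_ _ _ lp 0 I); apply/eqP.
  exact: (mean_curvature_neq0 m0 an0 b2 oT sm im sph ht bn0 I).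
split.
- exact: submanifold_hypersphere.
- by move=> p Mp; rewrite /sphere /= /enorm (hypersphere_dot ha0 ha1 Mp) sqrtr1.
- move=> U phi lp u Uu /=; have [oU sm im sph ht] := geom _ _ lp.
  rewrite (rough_laplacian_mean_curvature m0 an0 b2 oU sm im sph ht Uu).
  rewrite -scalerBl -scalerDl expr_div_n (_ : _ + _ = 0) ?scale0r//.
  by ring.
Qed.
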